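(* Let $I,J,M,N\subseteq\{1,\dots,n\}$ with $|I|=|J|$ and $|M|=|N|$. Then, for the standard Poisson bracket on $\mathcal{O}(M_n(k))$, $$\begin{aligned}\bigl\{[I|J],[M|N]\bigr\}&=\bigl(|I\cap M|-|J\cap N|\bigr)[I|J][M|N]\\&\quad+2\sum_{\substack{i\in I\setminus M\\ m\in M\setminus I\\ i<m}}(-1)^{|(I\Delta M)\cap(i,m)|}\,[(I\cup\{m\})\setminus\{i\}\,|\,J]\,[(M\cup\{i\})\setminus\{m\}\,|\,N]\\&\quad-2\sum_{\substack{j\in J\setminus N\\ p\in N\setminus J\\ j>p}}(-1)^{|(J\Delta N)\cap(p,j)|}\,[I\,|\,(J\cup\{p\})\setminus\{j\}]\,[M\,|\,(N\cup\{j\})\setminus\{p\}].\end{aligned}$$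
   Context: Let $k$ be a field (of any characteristic) and $n$ a positive integer. $\mathcal{O}(M_n(k))$ is the commutative polynomial ring over $k$ in indeterminates $x_{ij}$, $i,j=1,\dots,n$. A Poisson bracket on a commutative $k$-algebra $B$ is a $k$-bilinear map $\{-,-\}:B\times B\to B$ making $B$ a Lie algebra and such that $\{b,-\}$ is a derivation for each $b\in B$. The standard Poisson bracket on $\mathcal{O}(M_n(k))$ is the unique Poisson bracket with $\{x_{ij},x_{lj}\}=x_{ij}x_{lj}$ for $i<l$; $\{x_{ij},x_{im}\}=x_{ij}x_{im}$ for $j<m$; $\{x_{ij},x_{lm}\}=0$ for $i<l$, $j>m$; $\{x_{ij},x_{lm}\}=2x_{im}x_{lj}$ for $i<l$, $j<m$. For $I,J\subseteq\{1,\dots,n\}$ with $|I|=|J|$, $[I|J]$ denotes the classical minor: the determinant of the submatrix of $(x_{ij})$ with rows $I$ and columns $J$ (listed in ascending order); $[\varnothing|\varnothing]=1$. $\Delta$ is symmetric difference of sets, and $(a,b)$ denotes the open interval of integers strictly between $a$ and $b$. *)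

(* Defs.v *)
From mathcomp Require Export all_boot all_order all_algebra.
From mathcomp Require Export mpoly.

Set Implicit Arguments.
Unset Strict Implicit.
Unset Printing Implicit Defensive.

Import GRing.Theory.
Local Open Scope ring_scope.

(* The Lie bracket axioms are stated in any characteristic: the bracket is
   alternating, not just skew-symmetric. *)
Record is_poisson_bracket (k : fieldType) (B : comAlgType k)
    (br : B -> B -> B) : Prop := IsPoissonBracket {
  poisson_linear_l : forall b, linear (br^~ b);
  poisson_linear_r : forall b, linear (br b);
  poisson_alternating : forall b, br b b = 0;
  poisson_jacobi : forall a b c,
    br a (br b c) + br b (br c a) + br c (br a b) = 0;
  poisson_leibniz : forall b c d, br b (c * d) = br b c * d + c * br b d
}.

(* mxvec_index identifies the pairs (i, j) with the n * n variables. *)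
Definition genX (k : fieldType) (n : nat) (i j : 'I_n) : {mpoly k[(n * n)%N]} :=
  'X_(mxvec_index i j).

(* The four relations, together with the Poisson axioms, determine the bracket
   on the polynomial ring uniquely. *)
Record is_standard_poisson_bracket (k : fieldType) (n : nat)
    (br : {mpoly k[(n * n)%N]} -> {mpoly k[(n * n)%N]} -> {mpoly k[(n * n)%N]})
    : Prop := IsStandardPoissonBracket {
  standard_poisson : is_poisson_bracket br;
  standard_col : forall i l j : 'I_n, (i < l)%N ->
    br (genX k i j) (genX k l j) = genX k i j * genX k l j;
  standard_row : forall i j m : 'I_n, (j < m)%N ->
    br (genX k i j) (genX k i m) = genX k i j * genX k i m;
  standard_anti : forall i l j m : 'I_n, (i < l)%N -> (j > m)%N ->
    br (genX k i j) (genX k l m) = 0;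
  standard_diag : forall i l j m : 'I_n, (i < l)%N -> (j < m)%N ->
    br (genX k i j) (genX k l m) = 2%:R * (genX k i m * genX k l j)
}.

(* enum_val lists a set of ordinals in ascending order.  For #|I| = #|J|,
   conform_mx only recasts the #|I| x #|J| submatrix as a square one; when
   #|I| != #|J| the value is meaningless. *)
Definition minor (k : fieldType) (n : nat) (I J : {set 'I_n})
    : {mpoly k[(n * n)%N]} :=
  \det (conform_mx (0 : 'M_#|I|)
          (\matrix_(a < #|I|, b < #|J|) genX k (enum_val a) (enum_val b))).

Definition symdiff (T : finType) (A B : {set T}) : {set T} :=
  (A :\: B) :|: (B :\: A).

Definition ooint (n : nat) (a b : 'I_n) : {set 'I_n} :=
  [set c : 'I_n | (a < c < b)%N].

(* Main.v *)
(* The bracket is a biderivation and, for all indices,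
     {x_ij, x_lm} = (w(i,l) - w(m,j)) x_im x_lj,  w(i,l) = 2 [i < l] + [i = l].
   Since D(det A) = sum D(A_ab) cof_ab(A) for a derivation D, the bracket of
   two minors is a fourfold sum, in which the part with weight w(i,l) factors
   through sums over columns and the part with weight w(m,j) through sums over
   rows.  A sum  sum_b x_(l,J_b) cof_ab  is the minor [I|J] with its row i
   replaced by row l: it is [I|J] if l = i, vanishes for the other l in I, and
   is [I + l - i | J] up to sign if l is not in I. *)
Require Import Defs.
From mathcomp Require Import all_boot all_order all_algebra perm mpoly.
From mathcomp Require Import ring zify.

Set Implicit Arguments.
Unset Strict Implicit.
Unset Printing Implicit Defensive.

Import GRing.Theory.
Local Open Scope ring_scope.

(** * Derivations of products and determinants *)

Lemma derivation_prod (R : comNzRingType) (D : R -> R) (I : finType)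
    (P : pred I) (F : I -> R) :
    (forall x y, D (x * y) = D x * y + x * D y) ->
  D (\prod_(i | P i) F i)
  = \sum_(i | P i) D (F i) * \prod_(j | P j && (j != i)) F j.
Proof.
move=> DM.
have D1 : D 1 = 0.
  have /eqP := DM 1 1; rewrite !mulr1 mul1r -subr_eq0 opprD addNKr oppr_eq0.
  by move/eqP.
have [m] := ubnP #|P|; elim: m P => // m IHm P leP.
have [i Pi | P0] := pickP P; last by rewrite !big_pred0.
rewrite (bigD1 i) //= DM [RHS](bigD1 i) //=; congr (_ + _).
rewrite IHm; last by rewrite (cardD1x Pi) in leP.
rewrite mulr_sumr; apply: eq_bigr => j /andP[Pj nij].
rewrite [in RHS](bigD1 i) ?Pi 1?eq_sym //= mulrCA; congr (_ * (_ * _)).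
by apply: eq_bigl => l; rewrite -!andbA [(l != i) && _]andbC.
Qed.

(** In each product of the permutation expansion [D] hits one factor, that is, one row. Collecting
    by rows gives determinants with a single row [a] differentiated. Expanding along that row leaves
    the cofactors of [A], which do not see the change. *)
Lemma derivation_det (R : comNzRingType) (D : R -> R) (r : nat) (A : 'M[R]_r) :
    {morph D : x y / x + y} ->
    (forall x y, D (x * y) = D x * y + x * D y) ->
  D (\det A) = \sum_a \sum_b D (A a b) * cofactor A a b.
Proof.
move=> DD DM.
have D0 : D 0 = 0 by apply: (addrI (D 0)); rewrite -DD !addr0.
have DN x : D (- x) = - D x.
  by apply/eqP; rewrite -subr_eq0 opprK -DD addNr D0.
pose Arow a := \matrix_(i, j) (if i == a then D (A i j) else A i j).
transitivity (\sum_a \det (Arow a)).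
  rewrite (big_morph D DD D0) exchange_big; apply: eq_bigr => s _ /=.
  rewrite -mulr_sumr.
  have <- : D (\prod_i A i (s i)) = \sum_i \prod_j Arow i j (s j).
    rewrite derivation_prod //; apply: eq_bigr => i _.
    rewrite [RHS](bigD1 i) //= mxE eqxx; congr (_ * _).
    by apply: eq_bigr => j /negPf nji; rewrite mxE nji.
  by case: (odd_perm s); rewrite ?expr1 ?expr0 ?mulN1r ?mul1r ?DN.
apply: eq_bigr => a _; rewrite (expand_det_row _ a); apply: eq_bigr => b _.
rewrite mxE eqxx; congr (_ * (_ * \det _)).
by apply/matrixP => i j; rewrite !mxE eq_sym (negPf (neq_lift _ _)).
Qed.

(** * Ascending listings of index sets and submatrices *)

(** Expresses positions as counts of smaller elements, so that cofactor signs can be compared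
    through cardinalities. *)
Lemma index_enum_ord (n : nat) (I : {set 'I_n}) (i : 'I_n) :
  i \in I -> index i (enum I) = (\sum_(y in I) (y < i))%N.
Proof.
move=> iI; rewrite -big_enum /=.
have : sorted (fun x y : 'I_n => (x < y)%N) (enum I).
  apply: sorted_filter; first by move=> x y z; apply: ltn_trans.
  have := iota_ltn_sorted 0 n; rewrite -val_enum_ord sorted_map.
  by rewrite -enumT.
have : i \in enum I by rewrite mem_enum.
elim: (enum I) => // x s IHs; rewrite inE big_cons /=.
move=> xs sx; have := order_path_min _ sx => /(_ _)/allP xmin.
have {}xmin y : y \in s -> (x < y)%N.
  by apply: xmin => a b c; apply: ltn_trans.
case: (eqVneq i x) xs => [-> _ | nix /= si].
  rewrite ltnn big1_seq // => y /xmin; lia.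
by rewrite xmin // IHs // (path_sorted sx).
Qed.

(** [bump a] is what [lift] does to row indices, so the rows left in a cofactor are again the
    listing of a set. *)
Lemma nth_enum_setD1 (n : nat) (i0 : 'I_n) (I : {set 'I_n}) (a c : nat) :
    (a < #|I|)%N ->
  nth i0 (enum (I :\ nth i0 (enum I) a)) c = nth i0 (enum I) (bump a c).
Proof.
move=> aI; set i := nth _ _ a.
have -> : enum (I :\ i) = rem i (enum I).
  rewrite rem_filter ?enum_uniq // -filter_predI; apply: eq_filter => y.
  by rewrite !inE.
have aE : (a < size (enum I))%N by rewrite -cardE.
rewrite remE index_uniq ?enum_uniq // nth_cat (size_takel (ltnW aE)) /bump.
case: (ltnP c a) => ca; first by rewrite nth_take.
by rewrite nth_drop; congr nth; lia.
Qed.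

(** The size [r] is kept apart from [#|I|], so that all sets of equal cardinality give matrices of
    one type; [i0] is only the default of [nth]. *)
Definition listing (n : nat) (i0 : 'I_n) (r : nat) (I : {set 'I_n})
    (a : 'I_r) :=
  nth i0 (enum I) a.

Definition submx (R : nzRingType) (n : nat) (i0 : 'I_n) (X : 'M[R]_n) (r : nat)
    (I J : {set 'I_n}) : 'M[R]_r := mxsub (listing i0 I) (listing i0 J) X.

Lemma listing_in (n : nat) (i0 : 'I_n) (r : nat) (I : {set 'I_n}) (a : 'I_r) :
  #|I| = r -> listing i0 I a \in I.
Proof. by move=> cI; rewrite -mem_enum mem_nth // -cardE cI. Qed.

Lemma listing_surj (n : nat) (i0 : 'I_n) (r : nat) (I : {set 'I_n}) (i : 'I_n) :
  #|I| = r -> i \in I -> exists a : 'I_r, listing i0 I a = i.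
Proof.
move=> cI iI; have ltir : (index i (enum I) < r)%N.
  by rewrite -cI cardE index_mem mem_enum.
by exists (Ordinal ltir); rewrite /listing nth_index ?mem_enum.
Qed.

Lemma listing_inj (n : nat) (i0 : 'I_n) (r : nat) (I : {set 'I_n}) :
  #|I| = r -> injective (listing i0 I : 'I_r -> 'I_n).
Proof.
move=> cI a b /eqP; rewrite nth_uniq ?enum_uniq -?cardE ?cI //.
by move/eqP/val_inj.
Qed.

Lemma index_listing (n : nat) (i0 : 'I_n) (r : nat) (I : {set 'I_n})
    (a : 'I_r) :
  #|I| = r -> (\sum_(y in I) (y < listing i0 I a))%N = a.
Proof.
move=> cI; rewrite -index_enum_ord ?listing_in //.
by rewrite index_uniq ?enum_uniq -?cardE ?cI.
Qed.

Lemma sum_listing (V : nmodType) (n : nat) (i0 : 'I_n) (r : nat)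
    (I : {set 'I_n}) (F : 'I_n -> V) :
  #|I| = r -> \sum_(a < r) F (listing i0 I a) = \sum_(i in I) F i.
Proof.
by move=> <-; rewrite -[RHS]big_enum (big_nth i0) big_mkord /= -cardE.
Qed.

Lemma tr_submx (R : nzRingType) (n : nat) (i0 : 'I_n) (X : 'M[R]_n) (r : nat)
    (I J : {set 'I_n}) : (submx i0 X r I J)^T = submx i0 X^T r J I.
Proof. by apply/matrixP => a b; rewrite !mxE. Qed.

Lemma minorE (k : fieldType) (n : nat) (i0 : 'I_n) (r : nat)
    (I J : {set 'I_n}) :
    #|I| = r -> #|J| = r ->
  minor k I J = \det (submx i0 (\matrix_(i, j) genX k i j) r I J).
Proof.
move=> <- cJ; rewrite /minor; congr (\det _).
(* [enum_val b] ties the type of [b] to [#|J|]; with [nth] instead, [cJ] can be rewritten and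
   [conform_mx] becomes the identity. *)
have -> : \matrix_(a < #|I|, b < #|J|) genX k (enum_val a) (enum_val b)
    = \matrix_(a < #|I|, b < #|J|)
        genX k (nth i0 (enum I) a) (nth i0 (enum J) b).
  by apply/matrixP => a b; rewrite !mxE !(enum_val_nth i0).
by rewrite cJ conform_mx_id; apply/matrixP => a b; rewrite !mxE.
Qed.

Lemma cofactor_submx (R : nzRingType) (n : nat) (i0 : 'I_n) (X : 'M[R]_n)
    (r : nat) (I J : {set 'I_n}) (a b : 'I_r) : #|I| = r ->
  cofactor (submx i0 X r I J) a b
  = (-1) ^+ (a + b)
    * \det (mxsub (listing i0 (I :\ listing i0 I a))
                  (fun c => listing i0 J (lift b c)) X).
Proof.
move=> cI; congr (_ * \det _); apply/matrixP => c d; rewrite !mxE.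
by rewrite /listing nth_enum_setD1 ?cI.
Qed.

(** * Signs and row replacement *)

(** At least one of the two intervals is empty; the union is symmetric in [i] and [l], as both
    exchanges, [i] for [l] and [l] for [i], occur. *)
Definition between (n : nat) (i l : 'I_n) : {set 'I_n} :=
  ooint i l :|: ooint l i.

(** As [S] avoids both points, its counts below [i] and below [l] differ exactly by its elements
    strictly between them. *)
Lemma sign_listing (R : pzRingType) (n : nat) (i l : 'I_n) (S : {set 'I_n})
    (b : nat) :
    i \notin S -> l \notin S ->
  (-1) ^+ (\sum_(y in S) (y < i) + b)
  = (-1) ^+ #|S :&: between i l| * (-1) ^+ (\sum_(y in S) (y < l) + b) :> R.
Proof.
move=> iS lS.
have -> : #|S :&: between i l| = (\sum_(y in S) (y \in between i l))%N.
  by rewrite -sum1_card big_mkcond [RHS]big_mkcond; apply: eq_bigr => y _;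
     rewrite !inE; case: (y \in S).
have inS y : y \in S -> (y != i :> nat) && (y != l :> nat).
  by move=> yS; apply/andP; split; apply: contraTneq yS => /val_inj ->.
rewrite -exprD -signr_odd -[RHS]signr_odd; congr (_ ^+ nat_of_bool _).
case: (ltnP i l) => il.
  have -> : (\sum_(y in S) (y < l) = \sum_(y in S) (y < i)
            + \sum_(y in S) (y \in between i l))%N.
    by rewrite -big_split; apply: eq_bigr => y /inS; rewrite !inE /=; lia.
  by rewrite !oddD; do 3! case: odd.
have -> : (\sum_(y in S) (y < i) = \sum_(y in S) (y < l)
          + \sum_(y in S) (y \in between i l))%N.
  by rewrite -big_split; apply: eq_bigr => y /inS; rewrite !inE /=; lia.
by rewrite !oddD; do 3! case: odd.
Qed.

(* The effect on [I|J] of replacing row [i], for [i \in I], by row [l] of [X]. *)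
Definition polar (R : nzRingType) (n : nat) (i0 : 'I_n) (X : 'M[R]_n) (r : nat)
    (I J : {set 'I_n}) (i l : 'I_n) : R :=
  if l \in I then \det (submx i0 X r I J) *+ (l == i)
  else (-1) ^+ #|I :&: between i l|
       * \det (submx i0 X r ((I :|: [set l]) :\ i) J).

(* For [l \notin I], the sign is found by comparing the Laplace expansions of
   both sides along row [l]: the remaining rows are those of [I :\ i]. *)
Lemma sum_cofactor_row (R : comNzRingType) (n : nat) (i0 : 'I_n) (X : 'M[R]_n)
    (r : nat) (I J : {set 'I_n}) (a : 'I_r) (l : 'I_n) : #|I| = r ->
  \sum_b X l (listing i0 J b) * cofactor (submx i0 X r I J) a b
  = polar i0 X r I J (listing i0 I a) l.
Proof.
move=> cI; rewrite /polar; case: ifPn => [lI | lI].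
  have [c <-] := listing_surj i0 cI lI.
  (* For [l] in [I] the sum is the entry [(c, a)] of the matrix times its adjugate, a scalar
     matrix. *)
  have := congr1 (fun B : 'M_r => B c a) (mul_mx_adj (submx i0 X r I J)).
  rewrite !mxE (inj_eq (listing_inj (i0 := i0) cI)) => <-.
  by apply: eq_bigr => b _; rewrite !mxE.
set i := listing i0 I a; have iI : i \in I := listing_in i0 a cI.
set K := _ :\ i; have nli : l != i by apply: contraNneq lI => ->.
have lK : l \in K by rewrite !inE nli eqxx orbT.
have KI : K :\ l = I :\ i.
  apply/setP => y; rewrite !inE.
  by case: (eqVneq y l) => [-> |]; rewrite ?(negPf lI) ?andbF ?orbF.
have cK : #|K| = r.
  by rewrite (cardsD1 l K) lK KI -cI (cardsD1 i I) iI.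
have [c cl] := listing_surj i0 cK lK.
rewrite (expand_det_row _ c) mulr_sumr; apply: eq_bigr => b _.
rewrite !cofactor_submx // mxE -/i cl KI [RHS]mulrCA; congr (_ * _).
rewrite mulrA; congr (_ * _).
rewrite -(index_listing i0 a cI) -(index_listing i0 c cK) cl -/i.
(* No element lies below itself, so both positions become counts over the common set [I :\ i], which
   contains neither [i] nor [l]. *)
rewrite (big_setD1 _ iI) /= (big_setD1 _ lK) /= !ltnn !add0n KI.
rewrite (@sign_listing _ _ i l) ?inE ?eqxx ?(negPf lI) ?andbF //.
congr (_ ^+ _ * _); apply: eq_card => y; rewrite !inE.
by case: (eqVneq y i) => [->|//]; rewrite !ltnn !andbF.
Qed.

Lemma sum_cofactor_col (R : comNzRingType) (n : nat) (i0 : 'I_n) (X : 'M[R]_n)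
    (r : nat) (I J : {set 'I_n}) (b : 'I_r) (m : 'I_n) : #|J| = r ->
  \sum_a X (listing i0 I a) m * cofactor (submx i0 X r I J) a b
  = polar i0 X^T r J I (listing i0 J b) m.
Proof.
move=> cJ; rewrite -sum_cofactor_row //; apply: eq_bigr => a _.
by rewrite -tr_submx cofactor_tr mxE.
Qed.

(** * The bracket of two minors as weighted sums of replacements *)

Definition weight (R : pzSemiRingType) (n : nat) (i l : 'I_n) : R :=
  2%:R *+ (i < l)%N + 1 *+ (i == l).

Lemma bracket_submx (R : comNzRingType) (br : R -> R -> R) (n : nat)
    (i0 : 'I_n) (X : 'M[R]_n) (r s : nat) (I J M N : {set 'I_n}) :
    (forall a, {morph br a : x y / x + y}) ->
    (forall a, {morph br^~ a : x y / x + y}) ->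
    (forall a x y, br a (x * y) = br a x * y + x * br a y) ->
    (forall a x y, br (x * y) a = br x a * y + x * br y a) ->
    (forall i j l m, br (X i j) (X l m)
       = (weight R i l - weight R m j) * (X i m * X l j)) ->
    #|I| = r -> #|J| = r -> #|M| = s -> #|N| = s ->
  br (\det (submx i0 X r I J)) (\det (submx i0 X s M N))
  = \sum_(i in I) \sum_(l in M)
      weight R i l * (polar i0 X r I J i l * polar i0 X s M N l i)
    - \sum_(m in N) \sum_(j in J)
        weight R m j * (polar i0 X^T s N M m j * polar i0 X^T r J I j m).
Proof.
move=> brDr brDl brMr brMl brX cI cJ cM cN.
pose f := listing i0 I : 'I_r -> _; pose g := listing i0 J : 'I_r -> _.
pose h := listing i0 M : 'I_s -> _; pose q := listing i0 N : 'I_s -> _.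
pose C := cofactor (submx i0 X r I J); pose E := cofactor (submx i0 X s M N).
(* The bracket of entries exchanges their columns. Summing over [b] and [d] swaps the rows [f a] and
   [h c] between the minors; summing over [c] and [a] swaps the columns [q d] and [g b]. *)
pose F a b c d := X (h c) (g b) * C a b * (X (f a) (q d) * E c d).
transitivity (\sum_a \sum_b \sum_c \sum_d
    (weight R (f a) (h c) - weight R (q d) (g b)) * F a b c d).
  rewrite (derivation_det (D := br^~ _)) //; apply: eq_bigr => a _.
  apply: eq_bigr => b _; rewrite derivation_det // mulr_suml.
  apply: eq_bigr => c _; rewrite mulr_suml; apply: eq_bigr => d _.
  by rewrite !mxE brX /F /C /E /f /g /h /q; ring.
transitivity (\sum_a \sum_c weight R (f a) (h c)
      * ((\sum_b X (h c) (g b) * C a b) * (\sum_d X (f a) (q d) * E c d))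
    - \sum_d \sum_b weight R (q d) (g b)
      * ((\sum_c X (h c) (g b) * E c d) * (\sum_a X (f a) (q d) * C a b))).
  under eq_bigr => a _ do under eq_bigr => b _ do under eq_bigr => c _ do
    under eq_bigr => d _ do rewrite mulrBl.
  under eq_bigr => a _ do under eq_bigr => b _ do under eq_bigr => c _ do
    rewrite sumrB.
  under eq_bigr => a _ do under eq_bigr => b _ do rewrite sumrB.
  under eq_bigr => a _ do rewrite sumrB.
  rewrite sumrB; congr (_ - _).
    apply: eq_bigr => a _; rewrite exchange_big; apply: eq_bigr => c _.
    rewrite big_distrlr /= mulr_sumr; apply: eq_bigr => b _.
    by rewrite mulr_sumr.
  transitivity (\sum_a \sum_b \sum_d \sum_c weight R (q d) (g b) * F a b c d).
    by apply: eq_bigr => a _; apply: eq_bigr => b _; rewrite exchange_big.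
  transitivity (\sum_d \sum_b \sum_a \sum_c weight R (q d) (g b) * F a b c d).
    rewrite exchange_big [RHS]exchange_big; apply: eq_bigr => b _.
    by rewrite exchange_big.
  apply: eq_bigr => d _; apply: eq_bigr => b _.
  rewrite [X in _ * X]mulrC big_distrlr /= mulr_sumr; apply: eq_bigr => a _.
  by rewrite mulr_sumr; apply: eq_bigr => c _; rewrite /F; ring.
congr (_ - _).
  rewrite -(sum_listing i0 _ cI); apply: eq_bigr => a _.
  rewrite -(sum_listing i0 _ cM); apply: eq_bigr => c _.
  by rewrite !sum_cofactor_row.
rewrite -(sum_listing i0 _ cN); apply: eq_bigr => d _.
rewrite -(sum_listing i0 _ cJ); apply: eq_bigr => b _.
by rewrite !sum_cofactor_col.
Qed.

(** Off the diagonal, the first factor vanishes if [l] is in [I] and the second if [i] is in [M],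
    since a row is then repeated. The surviving signs combine because the cardinalities of two sets
    add up, modulo 2, to that of their symmetric difference. *)
Lemma sum_polar (R : comNzRingType) (n : nat) (i0 : 'I_n) (X : 'M[R]_n)
    (r s : nat) (I J M N : {set 'I_n}) (w : 'I_n -> 'I_n -> R) :
  \sum_(i in I) \sum_(l in M)
      w i l * (polar i0 X r I J i l * polar i0 X s M N l i)
  = (\sum_(i in I :&: M) w i i) * \det (submx i0 X r I J)
      * \det (submx i0 X s M N)
    + \sum_(i in I :\: M) \sum_(l in M :\: I) w i l
      * ((-1) ^+ #|symdiff I M :&: between i l|
         * \det (submx i0 X r ((I :|: [set l]) :\ i) J)
         * \det (submx i0 X s ((M :|: [set i]) :\ l) N)).
Proof.
rewrite (big_setID M) /=; congr (_ + _).
  rewrite !mulr_suml; apply: eq_bigr => i; rewrite inE => /andP[iI iM].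
  rewrite (bigD1 i) //= [X in _ + X]big1 => [|l /andP[lM li]].
    by rewrite addr0 /polar iI iM eqxx !mulr1n mulrA.
  rewrite [polar _ _ _ M _ _ _]/polar iM [i == l]eq_sym (negPf li).
  by rewrite mulr0n !mulr0.
apply: eq_bigr => i; rewrite inE => /andP[iM iI].
rewrite (big_setID I) /= [X in X + _]big1 ?add0r => [|l /setIP[lM lI]].
  apply: eq_bigr => l; rewrite inE => /andP[lI lM]; congr (_ * _).
  rewrite /polar (negPf lI) (negPf iM) mulrACA -exprD -!mulrA.
  congr (_ * _); rewrite -[LHS]signr_odd -[RHS]signr_odd.
  congr (_ ^+ nat_of_bool _).
  have -> : between l i = between i l by rewrite /between setUC.
  move: (between i l) => T.
  have -> : symdiff I M :&: T
      = (I :&: T :\: (M :&: T)) :|: (M :&: T :\: (I :&: T)).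
    apply/setP => y; rewrite !inE.
    by case: (y \in I); case: (y \in M); case: (y \in T).
  move: (I :&: T) (M :&: T) => A B.
  have dAB : [disjoint A :\: B & B :\: A].
    rewrite -setI_eq0; apply/eqP/setP => y; rewrite !inE.
    by case: (y \in A); case: (y \in B).
  rewrite cardsU (disjoint_setI0 dAB) cards0 subn0.
  by rewrite -(cardsID B A) -(cardsID A B) setIC !oddD; do 3! case: odd.
rewrite /polar lI; case: eqVneq => [li|_]; last by rewrite mulr0n mul0r mulr0.
by rewrite -li lM in iM.
Qed.

Lemma weight_lt (R : pzSemiRingType) (n : nat) (i l : 'I_n) :
  (i < l)%N -> weight R i l = 2%:R.
Proof. by move=> il; rewrite /weight il -val_eqE ltn_eqF // addr0. Qed.

Lemma weight_gt (R : pzSemiRingType) (n : nat) (i l : 'I_n) :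
  (l < i)%N -> weight R i l = 0.
Proof.
by move=> li; rewrite /weight ltnNge ltnW // -val_eqE gtn_eqF // addr0.
Qed.

Lemma weight_eq (R : pzSemiRingType) (n : nat) (i : 'I_n) : weight R i i = 1.
Proof. by rewrite /weight ltnn eqxx add0r. Qed.

(** Weight 1 on the diagonal counts [I :&: M]; the weight 0 for [l < i] leaves only the pairs with
    [i < l], where [between i l] is [ooint i l]. *)
Lemma sum_weight_polar (R : comNzRingType) (n : nat) (i0 : 'I_n) (X : 'M[R]_n)
    (r s : nat) (I J M N : {set 'I_n}) :
  \sum_(i in I) \sum_(l in M)
      weight R i l * (polar i0 X r I J i l * polar i0 X s M N l i)
  = #|I :&: M|%:R * \det (submx i0 X r I J) * \det (submx i0 X s M N)
    + 2%:R * \sum_(i in I :\: M) \sum_(l in M :\: I | (i < l)%N)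
      (-1) ^+ #|symdiff I M :&: ooint i l|
      * \det (submx i0 X r ((I :|: [set l]) :\ i) J)
      * \det (submx i0 X s ((M :|: [set i]) :\ l) N).
Proof.
rewrite (sum_polar _ _ _ _ _ _ _ _ (@weight R n)); congr (_ * _ * _ + _).
  by rewrite -sumr_const; apply: eq_bigr => i _; rewrite weight_eq.
rewrite mulr_sumr; apply: eq_bigr => i; rewrite inE => /andP[iM iI].
rewrite big_mkcondr mulr_sumr; apply: eq_bigr => l; rewrite inE => /andP[lI lM].
case: ltngtP => [il | li | /val_inj il].
- rewrite weight_lt // /between; have -> // : ooint l i = set0.
    by apply/setP => y; rewrite !inE; lia.
  by rewrite setU0.
- by rewrite weight_gt // mul0r mulr0.
- by rewrite -il iI in lI.
Qed.

(** * The standard bracket and the final formula *)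

Lemma card_exchange (T : finType) (A : {set T}) (x y : T) :
  x \in A -> y \notin A -> #|(A :|: [set y]) :\ x| = #|A|.
Proof.
move=> xA yA; have := cardsD1 x (A :|: [set y]).
by rewrite setUC cardsU1 yA !inE xA orbT => /addnI.
Qed.

(** Of the nine relative positions, four are the defining relations, four follow by skew-symmetry,
    and equal generators need alternation, which skew-symmetry does not give in characteristic 2. *)
Lemma standard_bracketE (k : fieldType) (n : nat)
    (br : {mpoly k[(n * n)%N]} -> {mpoly k[(n * n)%N]} -> {mpoly k[(n * n)%N]}) :
    is_standard_poisson_bracket br ->
    (forall x y, br x y = - br y x) ->
  forall i j l m : 'I_n, br (genX k i j) (genX k l m)
    = (weight _ i l - weight _ m j) * (genX k i m * genX k l j).
Proof.
case=> -[_ _ alt _ _] col row anti diag brC i j l m.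
case: (ltngtP i l) => [il|li|/val_inj il];
  case: (ltngtP j m) => [jm|mj|/val_inj jm]; rewrite -?il -?jm.
- by rewrite diag // weight_lt // weight_gt // subr0.
- by rewrite anti // !weight_lt // subrr mul0r.
- by rewrite col // weight_lt // weight_eq; ring.
- by rewrite brC anti // !weight_gt // subrr mul0r oppr0.
- by rewrite brC diag // weight_gt // weight_lt //; ring.
- by rewrite brC col // weight_gt // weight_eq; ring.
- by rewrite row // weight_eq weight_gt //; ring.
- by rewrite brC row // weight_eq weight_lt //; ring.
- by rewrite alt !weight_eq subrr mul0r.
Qed.

Theorem theorem7p4 (k : fieldType) (n : nat) (hn : (0 < n)%N)
    (br : {mpoly k[(n * n)%N]} -> {mpoly k[(n * n)%N]} -> {mpoly k[(n * n)%N]})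
    (hbr : is_standard_poisson_bracket br)
    (I J M N : {set 'I_n}) (hIJ : #|I| = #|J|) (hMN : #|M| = #|N|) :
  br (minor k I J) (minor k M N)
  = (#|I :&: M|%:R - #|J :&: N|%:R) * minor k I J * minor k M N
    + 2%:R * (\sum_(i in I :\: M) \sum_(m in M :\: I | (i < m)%N)
        (-1) ^+ #|symdiff I M :&: ooint i m|
        * minor k ((I :|: [set m]) :\ i) J * minor k ((M :|: [set i]) :\ m) N)
    - 2%:R * (\sum_(j in J :\: N) \sum_(p in N :\: J | (j > p)%N)
        (-1) ^+ #|symdiff J N :&: ooint p j|
        * minor k I ((J :|: [set p]) :\ j) * minor k M ((N :|: [set j]) :\ p)).
Proof.
have brBr := poisson_linear_r (standard_poisson hbr).
have brBl := poisson_linear_l (standard_poisson hbr).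
have brDr a : {morph br a : x y / x + y}.
  by move=> x y; have := brBr a 1 x y; rewrite !scale1r.
have brDl a : {morph br^~ a : x y / x + y}.
  by move=> x y; have := brBl a 1 x y; rewrite !scale1r.
have alt := poisson_alternating (standard_poisson hbr).
have brC x y : br x y = - br y x.
  have := alt (x + y); rewrite brDr; have /= -> := brDl x x y.
  have /= -> := brDl y x y; rewrite !alt add0r addr0 addrC.
  by move/eqP; rewrite addr_eq0 => /eqP.
have brMr a x y := poisson_leibniz (standard_poisson hbr) a x y.
have brMl a x y : br (x * y) a = br x a * y + x * br y a.
  by rewrite brC brMr opprD -mulNr -mulrN -!brC.
pose i0 := Ordinal hn; pose X := \matrix_(i, j) genX k i j : 'M_n.
have brX i j l m : br (X i j) (X l m)
    = (weight _ i l - weight _ m j) * (X i m * X l j).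
  by rewrite !mxE; apply: standard_bracketE.
rewrite (minorE k i0 (erefl #|I|) (esym hIJ)).
rewrite (minorE k i0 (erefl #|M|) (esym hMN)).
rewrite (bracket_submx i0 brDr brDl brMr brMl brX) //.
rewrite (sum_weight_polar i0 X #|I| #|M| I J M N).
(* The column sum is a row sum for the transpose, with the two minors in the opposite order. *)
rewrite (sum_weight_polar i0 X^T #|M| #|I| N M J I).
rewrite -!tr_submx !det_tr [N :&: J]setIC -/X.
set S := \sum_(i in I :\: M) _; set S' := \sum_(i in I :\: M) _.
have -> : S = S'.
  apply: eq_bigr => i /setDP[iI iM]; apply: eq_bigr => m.
  case/andP=> /setDP[mM mI] _.
  rewrite [minor k _ J](minorE k i0 (r := #|I|)) ?card_exchange //.
  by rewrite [minor k _ N](minorE k i0 (r := #|M|)) ?card_exchange.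
set Z := \sum_(i in N :\: J) _; set Z' := \sum_(j in J :\: N) _.
have -> : Z = Z'.
  (* The transposed sum has the index in [N :\: J] outermost, the goal the one in [J :\: N]. *)
  rewrite /Z (exchange_big_dep (mem (J :\: N))) /= => [|m j _ /andP[]//].
  apply: eq_bigr => j jJN; apply: eq_big => [m|m /andP[mNJ _]].
    by rewrite jJN.
  have [jJ jN] := setDP jJN; have [mN mJ] := setDP mNJ.
  rewrite -!tr_submx !det_tr.
  rewrite [minor k I _](minorE k i0 (r := #|I|)) ?card_exchange //.
  rewrite [minor k M _](minorE k i0 (r := #|M|)) ?card_exchange //.
  by rewrite mulrAC /symdiff setUC.
move: (\det _) (\det _) S' Z' => A B C E.
ring.
Qed.
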